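(* Let $(X,\tau_X,A)$, $(Y,\tau_Y,B)$ and $(Z,\tau_Z,C)$ be soft topological spaces. Let $q:X\to Y$ and $e:A\to B$ be maps such that $(q,e):(X,\tau_X,A)\to(Y,\tau_Y,B)$ is a soft quotient map. Let $g:X\to Z$ and $d:A\to C$ be maps such that: (1) $g$ is constant on the fibres of $q$, i.e. $q(x)=q(x')$ implies $g(x)=g(x')$ for all $x,x'\in X$; (2) $d$ is constant on each fibre of $e$; equivalently (since $e$ is surjective) there is a necessarily unique map $h:B\to C$ with $d=h\circ e$. Then: (a) there exists a unique map $f:Y\to Z$ such that $f\circ q=g$; (b) $(f,h):(Y,\tau_Y,B)\to(Z,\tau_Z,C)$ is soft continuous if and only if $(g,d):(X,\tau_X,A)\to(Z,\tau_Z,C)$ is soft continuous; (c) $(f,h)$ is a soft quotient map if and only if $(g,d)$ is a soft quotient map.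
   Context: Universes and parameter sets are non-empty sets. A soft set over $X$ with parameter set $A$ is a pair $(F,A)$ with $F:A\to\mathcal P(X)$. Soft unions and intersections (of soft sets with the same parameter set) are taken parameterwise; the null soft set is $a\mapsto\emptyset$ and the absolute soft set is $a\mapsto X$. A soft topology $\tau_X$ on $X$ with respect to $A$ is a family of soft sets over $X$ with parameter set $A$ containing the null and absolute soft sets and closed under arbitrary soft unions and finite soft intersections; $(X,\tau_X,A)$ is then a soft topological space and members of $\tau_X$ are called soft open. A soft map $(f,e):(X,\tau_X,A)\to(Y,\tau_Y,B)$ is a pair of maps $f:X\to Y$, $e:A\to B$. The inverse soft image $\phi^{-1}_{f,e}(G,B)$ of a soft set $(G,B)$ over $Y$ is the soft set $a\mapsto f^{-1}(G(e(a)))$ over $X$. The soft map is soft continuous if $\phi^{-1}_{f,e}(G,B)\in\tau_X$ for every $(G,B)\in\tau_Y$. It is soft surjective if both $f$ and $e$ are surjective (equivalently, the induced image map on soft sets is surjective). It is a soft quotient map (also: $f$ is a soft $e$-quotient map) if it is soft surjective and, for every soft set $(G,B)$ over $Y$, $(G,B)\in\tau_Y$ if and only if $\phi^{-1}_{f,e}(G,B)\in\tau_X$. *)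

(* Defs.v *)
From mathcomp Require Import all_boot.
From mathcomp Require Import classical_sets functions.

Set Implicit Arguments.
Unset Strict Implicit.
Unset Printing Implicit Defensive.

Local Open Scope classical_set_scope.

(* A soft set (F, A) over X; the parameter set A is carried by the type. *)
Definition soft_set (X A : Type) : Type := A -> set X.

Definition soft_null (X A : Type) : soft_set X A := fun _ => set0.
Arguments soft_null : clear implicits.

Definition soft_absolute (X A : Type) : soft_set X A := fun _ => setT.
Arguments soft_absolute : clear implicits.

Definition soft_union (X A : Type) (S : set (soft_set X A)) : soft_set X A :=
  fun a => \bigcup_(F in S) F a.

Definition soft_inter (X A : Type) (F G : soft_set X A) : soft_set X A :=
  fun a => F a `&` G a.

(* Closure under finite soft intersections is given by the binary case
   together with the absolute soft set (the empty intersection). *)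
Record soft_topology (X A : Type) := SoftTopology {
  soft_open :> set (soft_set X A);
  soft_open_null : soft_open (soft_null X A);
  soft_open_absolute : soft_open (soft_absolute X A);
  soft_open_union : forall S : set (soft_set X A),
    S `<=` soft_open -> soft_open (soft_union S);
  soft_open_inter : forall F G : soft_set X A,
    soft_open F -> soft_open G -> soft_open (soft_inter F G)
}.

Definition soft_preimage (X Y A B : Type) (f : X -> Y) (e : A -> B)
    (G : soft_set Y B) : soft_set X A :=
  fun a => f @^-1` (G (e a)).

Definition soft_continuous (X Y A B : Type)
    (tauX : soft_topology X A) (tauY : soft_topology Y B)
    (f : X -> Y) (e : A -> B) : Prop :=
  forall G : soft_set Y B, soft_open tauY G ->
    soft_open tauX (soft_preimage f e G).

Definition soft_surjective (X Y A B : Type) (f : X -> Y) (e : A -> B) : Prop :=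
  set_surj [set: X] [set: Y] f /\ set_surj [set: A] [set: B] e.

Definition soft_quotient_map (X Y A B : Type)
    (tauX : soft_topology X A) (tauY : soft_topology Y B)
    (f : X -> Y) (e : A -> B) : Prop :=
  soft_surjective f e /\
  forall G : soft_set Y B,
    soft_open tauY G <-> soft_open tauX (soft_preimage f e G).

(* Main.v *)
Require Import Defs.
From mathcomp Require Import all_boot.
From mathcomp Require Import boolp classical_sets functions.

Set Implicit Arguments.
Unset Strict Implicit.
Unset Printing Implicit Defensive.

Local Open Scope classical_set_scope.

(** A map constant on the fibres of a surjection descends uniquely along it ([set_surj_factor]). For
    any factorisation, pulling [G] back along [(f, h)] and then along [(q, e)] is pulling it back
    along [(g, d)], so the quotient property of [(q, e)] makes the first pullback open in [tauY]
    exactly when the last is open in [tauX]. This transfers continuity and the openness half of the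
    quotient condition; [set_surj_comp_iff] transfers surjectivity. *)

Lemma set_surj_comp_inj (T U V : Type) (s : T -> U) (f f' : U -> V) :
  set_surj [set: T] [set: U] s -> f \o s = f' \o s -> f = f'.
Proof.
move=> s_surj eq_fs; apply/funext => u.
by have [t _ <-] := s_surj u I; exact: (congr1 (fun k : T -> V => k t) eq_fs).
Qed.

(** Choice gives a section [r] of [s], and [k \o r] is the factor; it is unique because surjections
    are right-cancellable. *)
Lemma set_surj_factor (T U V : Type) (s : T -> U) (k : T -> V) :
  set_surj [set: T] [set: U] s ->
  (forall t t', s t = s t' -> k t = k t') -> exists! f : U -> V, f \o s = k.
Proof.
move=> s_surj k_fibres.
have /choice[r rK] u : exists t, s t = u by have [t _ <-] := s_surj u I; exists t.
have krK : (k \o r) \o s = k.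
  (* The points [r (s t)] and [t] lie in the same fibre of [s]. *)
  by apply/funext => t; apply: k_fibres; rewrite rK.
by exists (k \o r); split=> // f fK; apply: (set_surj_comp_inj s_surj); rewrite fK.
Qed.

Lemma set_surj_comp_iff (T U V : Type) (s : T -> U) (f : U -> V) :
  set_surj [set: T] [set: U] s ->
  set_surj [set: U] [set: V] f <-> set_surj [set: T] [set: V] (f \o s).
Proof.
move=> s_surj; split=> f_surj v _.
  by have [u _ <-] := f_surj v I; have [t _ <-] := s_surj u I; exists t.
by have [t _ <-] := f_surj v I; exists (s t).
Qed.

Theorem theorem3p5p1 (X Y Z A B C : Type)
  (X_inh : inhabited X) (Y_inh : inhabited Y)
  (Z_inh : inhabited Z) (A_inh : inhabited A)
  (B_inh : inhabited B) (C_inh : inhabited C)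
  (tauX : soft_topology X A) (tauY : soft_topology Y B)
  (tauZ : soft_topology Z C)
  (q : X -> Y) (e : A -> B) (quot_qe : soft_quotient_map tauX tauY q e)
  (g : X -> Z) (d : A -> C)
  (g_fibres : forall x x' : X, q x = q x' -> g x = g x')
  (d_fibres : forall a a' : A, e a = e a' -> d a = d a') :
  (exists! h : B -> C, d = h \o e) /\
  (exists! f : Y -> Z, f \o q = g) /\
  (forall (f : Y -> Z) (h : B -> C), f \o q = g -> d = h \o e ->
    (soft_continuous tauY tauZ f h <-> soft_continuous tauX tauZ g d) /\
    (soft_quotient_map tauY tauZ f h <-> soft_quotient_map tauX tauZ g d)).
Proof.
have [[q_surj e_surj] quot_open] := quot_qe.
split.
  have [h [hK h_uniq]] := set_surj_factor e_surj d_fibres.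
  by exists h; split=> // h' /esym; exact: h_uniq.
split; first exact: set_surj_factor q_surj g_fibres.
move=> f h fK hK; subst g d.
(* The preimage under the composite is definitionally the iterated preimage. *)
have open_comp (G : soft_set Z C) :
    soft_open tauY (soft_preimage f h G) <->
    soft_open tauX (soft_preimage (f \o q) (h \o e) G).
  exact: quot_open.
have f_surj_iff := set_surj_comp_iff f q_surj.
have h_surj_iff := set_surj_comp_iff h e_surj.
split; split.
- by move=> fh_cont G /fh_cont /open_comp.
- by move=> gd_cont G /gd_cont /open_comp.
(* Openness of [G] in [tauZ] is linked to that of its pullback to [X] by passing through its
   pullback to [Y]. *)
- move=> [[/f_surj_iff g_surj /h_surj_iff d_surj] fh_open].
  by split=> // G; exact: iff_trans (fh_open G) (open_comp G).
- move=> [[/f_surj_iff f_surj /h_surj_iff h_surj] gd_open].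
  by split=> // G; exact: iff_trans (gd_open G) (iff_sym (open_comp G)).
Qed.
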